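(* Let $q$ be a prime power and $\mathcal{L}$ a non-empty set of lines of $\mathrm{PG}(n,q)$ satisfying (Pt), (Pl), (Sd) and (To) (see context). Let $M$ be a subspace of $\mathrm{PG}(n,q)$ and let $\ell\in\mathcal{L}$ be a line meeting $M$ in exactly one point. (a) If $\ell$ meets no line of $\mathcal{L}_M$, then $|\mathcal{L}|\ge q|\mathcal{L}_M|+1$. (b) If $\ell$ meets a line $s\in\mathcal{L}_M$ which contains exactly $\alpha$ $(q+1)$-$M$-points, then $|\mathcal{L}|\ge q|\mathcal{L}_M|-\alpha q^2+\alpha q+1\ge q|\mathcal{L}_M|-q^3+q^2+1$.
   Context: (Pt): every point of $\mathrm{PG}(n,q)$ lies on $0$ or $q+1$ lines of $\mathcal{L}$. (Pl): every plane contains $0$, $1$ or $q+1$ lines of $\mathcal{L}$. (Sd): every solid ($3$-dimensional subspace) contains $0$, $1$, $q+1$ or $2q+1$ lines of $\mathcal{L}$. (To): $|\mathcal{L}|\le q^5+q^4+q^3+q^2+q+1$. For a subspace $W$, $\mathcal{L}_W$ denotes the set of lines of $\mathcal{L}$ contained in $W$. A point $P$ is a $(q+1)$-$M$-point if exactly $q+1$ lines of $\mathcal{L}$ pass through $P$ and are contained in $M$. *)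

(* Defs.v *)
From HB Require Import structures.
From mathcomp Require Import all_boot all_order all_algebra all_field.
Set Implicit Arguments. Unset Strict Implicit. Unset Printing Implicit Defensive.
Import GRing.Theory.

(* Projective space PG(n,q) = lattice of subspaces of F^(n+1), F a finite
   field with q elements.  A subspace is represented by its canonical
   row-space matrix <<A>>%MS in 'M[F]_(n.+1); projective dimension d
   corresponds to vector rank d+1. *)

Section PG.
Variables (F : finFieldType) (n : nat).

Definition subspaces_of_rank (r : nat) : {set 'M[F]_(n.+1)} :=
  [set A : 'M[F]_(n.+1) | (<<A>>%MS == A) && (\rank A == r)].

Definition pg_points := subspaces_of_rank 1.
Definition pg_lines  := subspaces_of_rank 2.
Definition pg_planes := subspaces_of_rank 3.
Definition pg_solids := subspaces_of_rank 4.

(* L_W : lines of L contained in W *)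
Definition lines_in (L : {set 'M[F]_(n.+1)}) (W : 'M[F]_(n.+1)) :=
  [set l in L | (l <= W)%MS].

(* lines of L through the point P *)
Definition lines_through (L : {set 'M[F]_(n.+1)}) (P : 'M[F]_(n.+1)) :=
  [set l in L | (P <= l)%MS].

(* P is a (q+1)-M-point: exactly q+1 lines of L pass through P and lie in M *)
Definition qM_point (q : nat) (L : {set 'M[F]_(n.+1)}) (M P : 'M[F]_(n.+1)) :=
  (P \in pg_points) && (#|lines_in (lines_through L P) M| == q.+1).

End PG.

(* Main.v *)
Require Import Defs.
From mathcomp Require Import all_boot all_order all_algebra all_field.
From mathcomp Require Import zify.
Set Implicit Arguments. Unset Strict Implicit. Unset Printing Implicit Defensive.
Import GRing.Theory.

(* Let P = l :&: M.  The q + 1 lines of L through P are not skew to l, so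
   |L| >= q + 1 + #(lines of L skew to l).  Every line m of L_M missing P is
   skew to l, and the solid <l, m> holds at least q lines of L skew to l:
   by (Pl) and (Sd) the lines of that solid meeting l lie in a single plane.
   Group these lines m by their solid <l, m>.  A solid carrying k >= 2 of them
   meets M in a plane; the q + 1 lines of L through the common point C of two
   of them all lie in that plane, so C is a (q+1)-M-point, k <= q, and one of
   these lines passes through P.  Under (a) this is impossible; under (b) that
   line is s, so C lies on s, and C determines the solid.  Hence at most alpha
   solids carry more than one line, each costing at most q^2 - q, and
   alpha <= q because P itself is not a (q+1)-M-point. *)

Section RowSpaces.
Variables (F : fieldType) (k : nat).

Lemma submx_rank_geq m1 m2 (A : 'M[F]_(m1, k)) (B : 'M[F]_(m2, k)) :
  (A <= B)%MS -> \rank B <= \rank A -> (B <= A)%MS.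
Proof. by move=> sAB; rewrite (geq_leqif (mxrank_leqif_sup sAB)). Qed.

Lemma genmx_submx_rank_eq (A B : 'M[F]_k) : <<A>>%MS = A -> <<B>>%MS = B ->
  (A <= B)%MS -> \rank B <= \rank A -> A = B.
Proof.
move=> gA gB sAB rBA; rewrite -gA -gB; apply/genmxP.
by rewrite sAB (submx_rank_geq sAB rBA).
Qed.

Lemma mxrank_cap_geq m1 m2 m3 (X : 'M[F]_(m1, k)) (A : 'M[F]_(m2, k))
    (B : 'M[F]_(m3, k)) :
  (X <= A)%MS -> (X <= B)%MS -> \rank X <= \rank (A :&: B)%MS.
Proof. by move=> XA XB; apply: mxrankS; rewrite sub_capmx XA XB. Qed.

Lemma rank1_cap_eq0 m1 m2 (X : 'M[F]_(m1, k)) (Y : 'M[F]_(m2, k)) :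
  \rank X = 1 -> ~~ (X <= Y)%MS -> \rank (X :&: Y)%MS = 0.
Proof.
move=> rX; apply: contraNeq; rewrite -lt0n => rXY.
apply: submx_trans (capmxSr X Y); apply: submx_rank_geq (capmxSl X Y) _.
by rewrite rX.
Qed.

Lemma mxrank_cap_notsub m1 m2 (A : 'M[F]_(m1, k)) (B : 'M[F]_(m2, k)) :
  ~~ (B <= A)%MS -> \rank (A :&: B)%MS < \rank B.
Proof.
apply: contraNltn => rB; apply: submx_trans (capmxSl A B).
exact: submx_rank_geq (capmxSr A B) rB.
Qed.

Lemma mxrank_add_rank1 m1 m2 (A : 'M[F]_(m1, k)) (X : 'M[F]_(m2, k)) :
  \rank X = 1 -> ~~ (X <= A)%MS -> \rank (A + X)%MS = (\rank A).+1.
Proof.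
move=> rX XA; rewrite mxrank_disjoint_sum ?rX ?addn1 //.
by apply/eqP; rewrite -mxrank_eq0 capmxC rank1_cap_eq0.
Qed.

Lemma rank_row_notsub m (w : 'rV[F]_k) (A : 'M[F]_(m, k)) :
  ~~ (w <= A)%MS -> \rank w = 1.
Proof.
move=> wA; rewrite rank_rV; suff -> : w != 0%R by [].
by apply: contraNneq wA => ->; exact: sub0mx.
Qed.

Lemma mxrank_gt0_row m (Y : 'M[F]_(m, k)) : 0 < \rank Y ->
  exists2 y : 'rV[F]_(k), y != 0%R & (y <= Y)%MS.
Proof.
rewrite lt0n mxrank_eq0 -submx0 => /row_subPn[i Yi]; exists (row i Y) => //.
  by apply: contraNneq Yi => ->; rewrite sub0mx.
exact: row_sub.
Qed.

Lemma genmx_row_in_span2 (u w y : 'rV[F]_k) : y != 0%R -> (y <= u + w)%MS ->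
  <<y>>%MS = <<w>>%MS \/ exists c, <<y>>%MS = <<u + c *: w>>%MS.
Proof.
move=> nzy /sub_addsmxP[[c1 c2] /= ey].
have [a ea] : exists a, (c1 *m u = a *: u)%R by apply/sub_rVP; exact: submxMl.
have [b eb] : exists b, (c2 *m w = b *: w)%R by apply/sub_rVP; exact: submxMl.
rewrite {}ea {}eb in ey; have [a0 | an0] := eqVneq a 0%R.
  left; apply: eq_genmx; rewrite ey a0 scale0r add0r; apply: eqmx_scale.
  by apply: contraNneq nzy => b0; rewrite ey a0 b0 !scale0r addr0.
right; exists (b / a)%R; apply: eq_genmx.
have -> : y = (a *: (u + (b / a) *: w))%R.
  by rewrite ey scalerDr scalerA mulrCA divff // mulr1.
exact: eqmx_scale.
Qed.

End RowSpaces.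

Section ProjectiveSpace.
Variables (F : finFieldType) (n : nat).
Local Notation mx := 'M[F]_(n.+1).

Lemma genmx_subspace r (X : mx) : \rank X = r -> <<X>>%MS \in subspaces_of_rank F n r.
Proof. by move=> rX; rewrite inE genmx_id mxrank_gen rX !eqxx. Qed.

Lemma card_points_on_line (r : mx) : \rank r = 2 ->
  #|[set Y in pg_points F n | (Y <= r)%MS]| <= #|F|.+1.
Proof.
move=> rr; have [u nzu ur] : exists2 u : 'rV[F]_(n.+1), u != 0%R & (u <= r)%MS.
  by apply: mxrank_gt0_row; rewrite rr.
have /row_subPn[i wu] : ~~ (r <= u)%MS by apply/negP => /mxrankS; rewrite rr rank_rV nzu.
set w := row i r in wu.
have r_uw : (r <= u + w)%MS.
  apply: submx_rank_geq; first by rewrite addsmx_sub ur row_sub.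
  by rewrite rr mxrank_add_rank1 ?(rank_row_notsub wu) // rank_rV nzu.
pose g (o : option F) : mx := if o is Some c then <<u + c *: w>>%MS else <<w>>%MS.
have sub : [set Y in pg_points F n | (Y <= r)%MS] \subset g @: [set: option F].
  apply/subsetP=> Y; rewrite !inE => /andP[/andP[/eqP gY /eqP rY] Yr].
  have [y nzy yY] : exists2 y : 'rV[F]_(n.+1), y != 0%R & (y <= Y)%MS.
    by apply: mxrank_gt0_row; rewrite rY.
  have eY : Y = <<y>>%MS.
    by rewrite -gY; apply/genmxP; rewrite yY andbT (submx_rank_geq yY) // rY rank_rV nzy.
  have := genmx_row_in_span2 nzy (submx_trans yY (submx_trans Yr r_uw)).
  by rewrite -eY => -[-> | [c ->]]; apply/imsetP; [exists None | exists (Some c)].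
apply: leq_trans (subset_leq_card sub) _.
by apply: leq_trans (leq_imset_card _ _) _; rewrite cardsT card_option.
Qed.

End ProjectiveSpace.

Lemma setD2_nonempty (T : finType) (A : {set T}) a b :
  2 < #|A| -> exists x, x \in A :\ a :\ b.
Proof.
move=> A2; apply/card_gt0P; have := cardsD1 b (A :\ a); have := cardsD1 a A.
case: (a \in A); case: (b \in A :\ a); lia.
Qed.

Lemma sum_card_fibers (T U : finType) (f : T -> U) (A : {set T}) (B : {set U}) :
  \sum_(S in B) #|[set x in A | f x == S]| = #|[set x in A | f x \in B]|.
Proof.
rewrite -sum1_card (partition_big f (mem B)) /=; last by move=> x; rewrite inE => /andP[].
apply: eq_bigr => S SB; rewrite -sum1_card; apply: eq_bigl => x.
by rewrite !inE; case: eqP => [->|]; rewrite ?SB ?andbT ?andbF.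
Qed.

Lemma sum_card_fibers_le (T U : finType) (f : T -> U) (A : {set T}) (B : {set U}) :
  \sum_(S in B) #|[set x in A | f x == S]| <= #|A|.
Proof.
by rewrite sum_card_fibers; apply/subset_leq_card/subsetP=> x; rewrite inE => /andP[].
Qed.

Lemma sum_card_fibers_imset (T U : finType) (f : T -> U) (A : {set T}) :
  \sum_(S in f @: A) #|[set x in A | f x == S]| = #|A|.
Proof.
rewrite sum_card_fibers; apply: eq_card => x; rewrite inE.
by case xA: (x \in A); rewrite //= imset_f.
Qed.

Section Lines.
Variables (F : finFieldType) (n : nat).
Local Notation mx := 'M[F]_(n.+1).

Lemma lines_inP (L : {set mx}) x W :
  reflect (x \in L /\ (x <= W)%MS) (x \in lines_in L W).
Proof. by rewrite inE; apply: andP. Qed.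

Lemma lines_throughP (L : {set mx}) x X :
  reflect (x \in L /\ (X <= x)%MS) (x \in lines_through L X).
Proof. by rewrite inE; apply: andP. Qed.

Lemma pg_lineP (x : mx) : x \in pg_lines F n -> <<x>>%MS = x /\ \rank x = 2.
Proof. by rewrite inE => /andP[/eqP -> /eqP ->]. Qed.

Lemma pg_lines_eq (x y Z : mx) : x \in pg_lines F n -> y \in pg_lines F n ->
  \rank Z <= 2 -> (x <= Z)%MS -> (y <= Z)%MS -> x = y.
Proof.
move=> /pg_lineP[gx rx] /pg_lineP[gy ry] rZ xZ yZ.
have Zy : (Z <= y)%MS by apply: submx_rank_geq yZ _; rewrite ry.
by apply: genmx_submx_rank_eq => //; [apply: submx_trans Zy | rewrite rx ry].
Qed.

Lemma pg_line_cap_le1 (x Y : mx) : x \in pg_lines F n -> ~~ (x <= Y)%MS ->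
  \rank (x :&: Y)%MS <= 1.
Proof. by move=> /pg_lineP[_ rx] /mxrank_cap_notsub; rewrite capmxC rx. Qed.

Lemma mxrank_add_meet_line (x W X : mx) : x \in pg_lines F n -> \rank X = 1 ->
  (X <= x)%MS -> (X <= W)%MS -> ~~ (x <= W)%MS -> \rank (W + x)%MS = (\rank W).+1.
Proof.
move=> xL rX Xx XW xW; have [_ rx] := pg_lineP xL.
have := mxrank_cap_geq XW Xx; have := pg_line_cap_le1 xL xW.
have := mxrank_sum_cap W x; rewrite capmxC rx rX; lia.
Qed.

Lemma pg_lines_neq_sub (x y : mx) : x \in pg_lines F n -> y \in pg_lines F n ->
  x != y -> ~~ (x <= y)%MS.
Proof.
move=> xL yL; apply: contra => xy; apply/eqP.
by apply: (pg_lines_eq (Z := y) xL yL); rewrite ?(pg_lineP yL).2.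
Qed.

Lemma pg_lines_meet (x y X : mx) : x \in pg_lines F n -> y \in pg_lines F n ->
  x != y -> \rank X = 1 -> (X <= x)%MS -> (X <= y)%MS -> \rank (x + y)%MS = 3.
Proof.
move=> xL yL xy rX Xx Xy; rewrite (mxrank_add_meet_line yL rX Xy Xx) ?(pg_lineP xL).2 //.
by rewrite pg_lines_neq_sub // eq_sym.
Qed.

Lemma pg_lines_meet_cap (x y : mx) : x \in pg_lines F n -> y \in pg_lines F n ->
  x != y -> 0 < \rank (x :&: y)%MS -> \rank (x + y)%MS = 3.
Proof.
move=> xL yL xy xy0; apply: (pg_lines_meet xL yL xy _ (capmxSl x y) (capmxSr x y)).
by have := pg_line_cap_le1 xL (pg_lines_neq_sub xL yL xy); lia.
Qed.

Lemma pg_lines_coplanar_cap (x y W : mx) : x \in pg_lines F n -> y \in pg_lines F n ->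
  ~~ (x <= y)%MS -> \rank W <= 3 -> (x <= W)%MS -> (y <= W)%MS -> \rank (x :&: y)%MS = 1.
Proof.
move=> xL yL xy rW xW yW; have [_ rx] := pg_lineP xL; have [_ ry] := pg_lineP yL.
have := mxrankS (_ : (x + y <= W)%MS); rewrite addsmx_sub xW yW => /(_ isT).
have := pg_line_cap_le1 xL xy; have := mxrank_sum_cap x y; rewrite rx ry; lia.
Qed.

Lemma pg_lines_eq_points (x y C Y : mx) : x \in pg_lines F n -> y \in pg_lines F n ->
    \rank C = 1 -> \rank Y = 1 -> ~~ (C <= Y)%MS ->
    (C <= x)%MS -> (Y <= x)%MS -> (C <= y)%MS -> (Y <= y)%MS ->
  x = y.
Proof.
move=> xL yL rC rY CY Cx Yx Cy Yy.
have rYC : \rank (Y + C)%MS = 2 by rewrite mxrank_add_rank1 ?rY.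
have [[_ rx] [_ ry]] := (pg_lineP xL, pg_lineP yL).
apply: (pg_lines_eq xL yL (_ : \rank (Y + C)%MS <= 2)); rewrite ?rYC //.
  by apply: submx_rank_geq; rewrite ?addsmx_sub ?Yx ?Cx ?rx ?rYC.
by apply: submx_rank_geq; rewrite ?addsmx_sub ?Yy ?Cy ?ry ?rYC.
Qed.

Lemma pg_line_avoiding (pi C P : mx) : \rank pi = 3 -> \rank C = 1 -> \rank P = 1 ->
    (C <= pi)%MS -> (P <= pi)%MS -> ~~ (P <= C)%MS ->
  exists2 r, r \in pg_lines F n & [&& (P <= r)%MS, (r <= pi)%MS & ~~ (C <= r)%MS].
Proof.
move=> rpi rC rP Cpi Ppi PC.
have rCP : \rank (C + P)%MS = 2 by rewrite mxrank_add_rank1 ?rC.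
have /row_subPn[i wCP] : ~~ (pi <= C + P)%MS by apply/negP => /mxrankS; rewrite rpi rCP.
set w := row i pi in wCP.
have wP : ~~ (w <= P)%MS by apply: contra wCP => /submx_trans; apply; exact: addsmxSr.
have rPw : \rank (P + w)%MS = 2 by rewrite mxrank_add_rank1 ?rP ?(rank_row_notsub wP).
exists <<(P + w)%MS>>%MS; first exact: genmx_subspace.
rewrite !genmxE addsmxSl addsmx_sub Ppi row_sub /=.
apply: contra wCP => Cw; apply: submx_trans (addsmxSr P w) _.
by apply: submx_rank_geq; rewrite ?addsmx_sub ?Cw ?addsmxSl ?rPw ?rCP.
Qed.

Lemma pencil_covers_plane (pi C P : mx) (X : {set mx}) :
    \rank pi = 3 -> \rank C = 1 -> \rank P = 1 -> (C <= pi)%MS -> (P <= pi)%MS ->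
    X \subset pg_lines F n -> #|X| = #|F|.+1 ->
    (forall x, x \in X -> (C <= x)%MS && (x <= pi)%MS) ->
  exists2 x, x \in X & (P <= x)%MS.
Proof.
move=> rpi rC rP Cpi Ppi Xlines cardX CXpi.
have [PC|nPC] := boolP (P <= C)%MS.
  have [x xX] : exists x, x \in X by apply/card_gt0P; rewrite cardX.
  by exists x => //; have /andP[Cx _] := CXpi x xX; apply: submx_trans Cx.
(* The #|F| + 1 lines of X cut a line r through P, missing C, in distinct
   points, hence in every point of r. *)
have [r rL /and3P[Pr rpi' nCr]] := pg_line_avoiding rpi rC rP Cpi Ppi nPC.
pose h (x : mx) := <<(x :&: r)%MS>>%MS.
have rank_xr x : x \in X -> \rank (x :&: r)%MS = 1.
  move=> xX; have /andP[Cx xpi] := CXpi x xX.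
  apply: pg_lines_coplanar_cap (subsetP Xlines x xX) rL _ _ xpi rpi'; last by rewrite rpi.
  by apply: contra nCr; apply: submx_trans.
have h_inj : {in X &, injective h}.
  move=> x x' xX x'X /genmxP /andP[sxx' _].
  have /andP[Cx _] := CXpi x xX; have /andP[Cx' _] := CXpi x' x'X.
  apply: (pg_lines_eq_points (subsetP Xlines x xX) (subsetP Xlines x' x'X) rC (rank_xr x xX)).
  - by apply: contra nCr => /submx_trans; apply; exact: capmxSr.
  - exact: Cx.
  - exact: capmxSl.
  - exact: Cx'.
  - exact: submx_trans sxx' (capmxSl _ _).
have : h @: X = [set Y in pg_points F n | (Y <= r)%MS].
  apply/eqP; rewrite eqEcard (card_in_imset h_inj) cardX.
  rewrite (card_points_on_line (pg_lineP rL).2) ?andbT.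
  apply/subsetP=> _ /imsetP[x xX ->]; rewrite inE genmxE capmxSr andbT.
  exact: genmx_subspace (rank_xr x xX).
move/setP/(_ <<P>>%MS); rewrite inE genmx_subspace // genmxE Pr.
case/imsetP=> x xX /genmxP /andP[Pxr _]; exists x => //.
exact: submx_trans Pxr (capmxSl _ _).
Qed.

End Lines.

Section LineSet.
Variables (F : finFieldType) (n q : nat).
Local Notation mx := 'M[F]_(n.+1).
Hypothesis hq : #|F| = q.
Variable L : {set mx}.
Hypothesis Lsub : L \subset pg_lines F n.
Hypothesis Pt : forall P, P \in pg_points F n ->
  #|lines_through L P| = 0 \/ #|lines_through L P| = q.+1.
Hypothesis Pl : forall W, W \in pg_planes F n -> #|lines_in L W| \in [:: 0; 1; q.+1].
Hypothesis Sd : forall W, W \in pg_solids F n ->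
  #|lines_in L W| \in [:: 0; 1; q.+1; (2 * q).+1].

Lemma L_pg_line x : x \in L -> x \in pg_lines F n.
Proof. exact: subsetP. Qed.

Lemma rank_L x : x \in L -> \rank x = 2.
Proof. by move/L_pg_line/pg_lineP=> []. Qed.

Lemma lines_in_genmx W : lines_in L <<W>>%MS = lines_in L W.
Proof. by apply/setP=> t; rewrite !inE genmxE. Qed.

Lemma lines_through_genmx X : lines_through L <<X>>%MS = lines_through L X.
Proof. by apply/setP=> t; rewrite !inE genmxE. Qed.

Lemma lines_inI A B : lines_in L (A :&: B)%MS = lines_in L A :&: lines_in L B.
Proof. by apply/setP=> t; rewrite !inE sub_capmx; case: (t \in L). Qed.

Lemma card_lines_through X x : \rank X = 1 -> x \in L -> (X <= x)%MS ->
  #|lines_through L X| = q.+1.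
Proof.
move=> rX xL Xx; rewrite -lines_through_genmx.
case: (Pt (genmx_subspace rX)) => // /eqP; rewrite cards_eq0 => /eqP/setP/(_ x).
by rewrite !inE genmxE xL Xx.
Qed.

Lemma card_lines_in_plane W : \rank W = 3 -> #|lines_in L W| \in [:: 0; 1; q.+1].
Proof. by move=> rW; rewrite -lines_in_genmx; apply: Pl; exact: genmx_subspace. Qed.

Lemma card_lines_in_solid W : \rank W = 4 ->
  [\/ #|lines_in L W| <= 1, #|lines_in L W| = q.+1 | #|lines_in L W| = (2 * q).+1].
Proof.
move=> rW; have := Sd (genmx_subspace rW); rewrite lines_in_genmx !inE.
by case/or4P=> /eqP ->; [apply: Or31 | apply: Or31 | apply: Or32 | apply: Or33].
Qed.

Lemma card_lines_in_solid_gt1 W : \rank W = 4 -> 1 < #|lines_in L W| ->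
  q.+1 <= #|lines_in L W|.
Proof. by move=> /card_lines_in_solid[|->|->]; lia. Qed.

Lemma card_lines_in_solid_gtq W : \rank W = 4 -> q.+1 < #|lines_in L W| ->
  #|lines_in L W| = (2 * q).+1.
Proof. by move=> /card_lines_in_solid[|->|->]; lia. Qed.

Lemma card_lines_in_plane_le W : \rank W = 3 -> #|lines_in L W| <= q.+1.
Proof. by move/card_lines_in_plane; rewrite !inE => /or3P[] /eqP ->. Qed.

Lemma full_plane W a b : \rank W = 3 -> a \in lines_in L W -> b \in lines_in L W ->
  a != b -> #|lines_in L W| = q.+1.
Proof.
move=> rW aW bW ab; have : 1 < #|lines_in L W| by apply/card_gt1P; exists a, b.
by have := card_lines_in_plane rW; rewrite !inE => /or3P[] /eqP ->.
Qed.

Lemma card_lines_in_rank_le2 Z : \rank Z <= 2 -> #|lines_in L Z| <= 1.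
Proof.
move=> rZ; apply/card_le1_eqP => x y; rewrite !inE => /andP[xL xZ] /andP[yL yZ].
exact: pg_lines_eq (L_pg_line yL) (L_pg_line xL) rZ yZ xZ.
Qed.

Lemma planes_share_le1 W1 W2 : \rank W2 = 3 -> ~~ (W2 <= W1)%MS ->
  #|lines_in L W1 :&: lines_in L W2| <= 1.
Proof.
move=> r2 W21; rewrite -lines_inI; apply: card_lines_in_rank_le2.
by have := mxrank_cap_notsub W21; rewrite r2.
Qed.

Lemma planes_share_line W1 W2 x y : \rank W2 = 3 -> ~~ (W2 <= W1)%MS ->
    x \in lines_in L W1 -> x \in lines_in L W2 ->
    y \in lines_in L W1 -> y \in lines_in L W2 ->
  x = y.
Proof.
move=> r2 W21 x1 x2 y1 y2; move/card_le1_eqP: (planes_share_le1 r2 W21).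
by apply; rewrite inE ?x1 ?y1.
Qed.

Lemma full_planes_in_solid S W1 W2 x : \rank S = 4 -> \rank W2 = 3 ->
    (W1 <= S)%MS -> (W2 <= S)%MS -> ~~ (W2 <= W1)%MS ->
    #|lines_in L W1| = q.+1 -> #|lines_in L W2| = q.+1 ->
  x \in lines_in L S -> x \in lines_in L W1 :|: lines_in L W2.
Proof.
move=> rS r2 W1S W2S W21 c1 c2 xS; apply: contraT => x12.
have : x |: (lines_in L W1 :|: lines_in L W2) \subset lines_in L S.
  apply/subsetP=> y; rewrite !inE => /or3P[/eqP -> | /andP[-> yW] | /andP[-> yW]].
  - by apply/andP/lines_inP.
  - exact: submx_trans yW W1S.
  - exact: submx_trans yW W2S.
move/subset_leq_card; rewrite cardsU1 (negbTE x12) cardsU c1 c2.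
have := planes_share_le1 r2 W21; case: (card_lines_in_solid rS); lia.
Qed.

Lemma lines_through_in_span a b X t : a \in L -> b \in L -> a != b -> \rank X = 1 ->
    (X <= a)%MS -> (X <= b)%MS -> t \in lines_through L X ->
  (t <= a + b)%MS.
Proof.
move=> aL bL ab rX Xa Xb /lines_throughP[tL Xt]; apply: contraT => tW.
set W := (a + b)%MS.
have full u v : u \in L -> v \in L -> u != v -> (X <= u)%MS -> (X <= v)%MS ->
    \rank (u + v)%MS = 3 /\ #|lines_in L (u + v)%MS| = q.+1.
  move=> uL vL uv Xu Xv; have ruv := pg_lines_meet (L_pg_line uL) (L_pg_line vL) uv rX Xu Xv.
  by split=> //; apply: full_plane ruv _ _ uv; rewrite inE ?uL ?vL ?addsmxSl ?addsmxSr.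
have ta : t != a by apply: contraNneq tW => ->; exact: addsmxSl.
have tb : t != b by apply: contraNneq tW => ->; exact: addsmxSr.
have [rW cW] := full a b aL bL ab Xa Xb.
have [rta cta] := full t a tL aL ta Xt Xa.
have [rtb ctb] := full t b tL bL tb Xt Xb.
have rS : \rank (W + t)%MS = 4.
  by rewrite (mxrank_add_meet_line (L_pg_line tL) rX Xt) ?rW // (submx_trans Xa) ?addsmxSl.
have sub_S (u : mx) : (u <= W)%MS -> (t + u <= W + t)%MS.
  by move=> uW; rewrite addsmx_sub addsmxSr (submx_trans uW) ?addsmxSl.
have taW : ~~ (t + a <= W)%MS by apply: contra tW; apply: submx_trans; exact: addsmxSl.
have tbW : ~~ (t + b <= W)%MS by apply: contra tW; apply: submx_trans; exact: addsmxSl.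
have tbta : ~~ (t + b <= t + a)%MS.
  apply: contra tW => tbta; apply: submx_trans (addsmxSl t a) _.
  apply: submx_rank_geq; last by rewrite rta rW.
  by rewrite addsmx_sub addsmxSr (submx_trans _ tbta) ?addsmxSr.
(* A third line x of the plane t + b lies neither in W nor in t + a. *)
have [x] : exists x, x \in lines_in L (t + b)%MS :\ t :\ b.
  by apply: setD2_nonempty; rewrite ctb ltnS -hq card_finNzRing_gt1.
rewrite !inE => /and3P[xb xt /andP[xL xtb]].
have xS : x \in lines_in L (W + t)%MS by rewrite inE xL (submx_trans xtb) ?sub_S ?addsmxSr.
have xtb' : x \in lines_in L (t + b)%MS by rewrite inE xL xtb.
have := full_planes_in_solid rS rta (addsmxSl W t) (sub_S a (addsmxSl a b)) taW cW cta xS.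
rewrite inE => /orP[] xP.
- by case/eqP: xb; apply: (planes_share_line rtb tbW xP xtb'); rewrite inE bL addsmxSr.
- by case/eqP: xt; apply: (planes_share_line rtb tbta xP xtb'); rewrite inE tL addsmxSl.
Qed.

Definition skew_lines (l : mx) := [set t in L | \rank (l :&: t)%MS == 0].

Lemma skew_lines_L l m : m \in skew_lines l -> m \in L.
Proof. by rewrite inE => /andP[]. Qed.

Lemma notin_skew_lines l : l \in L -> l \notin skew_lines l.
Proof.
move=> lL; rewrite inE negb_and -lt0n orbC; apply/orP; left.
by apply: leq_trans (mxrank_cap_geq (submx_refl l) (submx_refl l)); rewrite rank_L.
Qed.

Lemma rank_add_skew l m : l \in L -> m \in skew_lines l -> \rank (l + m)%MS = 4.
Proof.
move=> lL; rewrite inE => /andP[mL /eqP lm].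
by have := mxrank_sum_cap l m; rewrite lm (rank_L lL) (rank_L mL) addn0.
Qed.

Lemma skew_notin_rank3 l m (Z : mx) : l \in L -> m \in skew_lines l ->
  (l <= Z)%MS -> \rank Z <= 3 -> ~~ (m <= Z)%MS.
Proof.
move=> lL ml lZ rZ; apply/negP => mZ.
have lmZ : (l + m <= Z)%MS by rewrite addsmx_sub lZ mZ.
by have := mxrankS lmZ; rewrite (rank_add_skew lL ml) => /leq_trans /(_ rZ).
Qed.

Lemma meeting_lines_coplanar l m t x : l \in L -> m \in skew_lines l ->
    t \in lines_in L (l + m)%MS -> x \in lines_in L (l + m)%MS -> t != l -> x != l ->
    0 < \rank (l :&: t)%MS -> 0 < \rank (l :&: x)%MS ->
  (x <= l + t)%MS.
Proof.
move=> lL ml /lines_inP[tL tS] /lines_inP[xL xS] tl xl lt lx; apply: contraT => xW.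
have plane u : u \in L -> (u <= l + m)%MS -> u != l -> 0 < \rank (l :&: u)%MS ->
    [/\ \rank (l + u)%MS = 3, #|lines_in L (l + u)%MS| = q.+1 & (l + u <= l + m)%MS].
  move=> uL uS ul lu; have rlu : \rank (l + u)%MS = 3.
    by apply: pg_lines_meet_cap; rewrite ?L_pg_line // eq_sym.
  split=> //; last by rewrite addsmx_sub addsmxSl.
  by apply: full_plane rlu _ _ ul; rewrite inE ?uL ?lL ?addsmxSl ?addsmxSr.
have [rlt ct ltS] := plane t tL tS tl lt; have [rlx cx lxS] := plane x xL xS xl lx.
have W21 : ~~ (l + x <= l + t)%MS by apply: contra xW; apply: submx_trans; exact: addsmxSr.
have mS : m \in lines_in L (l + m)%MS by rewrite inE (skew_lines_L ml) addsmxSr.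
have := full_planes_in_solid (rank_add_skew lL ml) rlx ltS lxS W21 ct cx mS.
have mt : ~~ (m <= l + t)%MS by rewrite (skew_notin_rank3 lL ml) ?addsmxSl ?rlt.
have mx : ~~ (m <= l + x)%MS by rewrite (skew_notin_rank3 lL ml) ?addsmxSl ?rlx.
by rewrite !inE (negbTE mt) (negbTE mx) !andbF.
Qed.

Lemma card_skew_lines_in_solid_meeting l m t : l \in L -> m \in skew_lines l ->
    t \in lines_in L (l + m)%MS -> t != l -> 0 < \rank (l :&: t)%MS ->
  q <= #|[set u in skew_lines l | (u <= l + m)%MS]|.
Proof.
move=> lL ml tS tl lt; have /lines_inP[tL tSS] := tS.
set S := (l + m)%MS; set T := [set u in skew_lines l | (u <= S)%MS].
have rlt : \rank (l + t)%MS = 3 by apply: pg_lines_meet_cap; rewrite ?L_pg_line // eq_sym.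
have ct : #|lines_in L (l + t)%MS| = q.+1.
  by apply: (full_plane rlt (a := t) (b := l)); rewrite ?inE ?lL ?tL ?addsmxSl ?addsmxSr.
have mW : m \notin lines_in L (l + t)%MS.
  by rewrite inE negb_and (skew_notin_rank3 lL ml) ?addsmxSl ?rlt ?orbT.
have : m |: lines_in L (l + t)%MS \subset lines_in L S.
  apply/subsetP=> x; rewrite in_setU1 => /orP[/eqP -> | ].
    by rewrite inE (skew_lines_L ml) addsmxSr.
  by rewrite !inE => /andP[-> /submx_trans]; apply; rewrite addsmx_sub addsmxSl.
move/subset_leq_card; rewrite cardsU1 mW ct => big.
have : lines_in L S \subset T :|: lines_in L (l + t)%MS.
  apply/subsetP=> x xS; have /lines_inP[xL xSS] := xS.
  have [lx0 | lx] := eqVneq (\rank (l :&: x)%MS) 0; first by rewrite !inE xL lx0 xSS.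
  rewrite !inE xL /=; apply/orP; right.
  have [-> | xl] := eqVneq x l; first exact: addsmxSl.
  by apply: (meeting_lines_coplanar lL ml tS xS tl xl lt); rewrite lt0n.
move/subset_leq_card/leq_trans/(_ (leq_card_setU _ _)).
rewrite (card_lines_in_solid_gtq (rank_add_skew lL ml) big) ct.
by rewrite mul2n -addnn addnS ltnS leq_add2r.
Qed.

Lemma card_skew_lines_in_solid l m : l \in L -> m \in skew_lines l ->
  q <= #|[set t in skew_lines l | (t <= l + m)%MS]|.
Proof.
move=> lL ml; set S := (l + m)%MS.
case: (pickP [pred t in lines_in L S | (t != l) && (0 < \rank (l :&: t)%MS)]) => [t | no_meet].
  by move=> /andP[tS /andP[tl lt]]; exact: card_skew_lines_in_solid_meeting tS tl lt.
set T := [set t in skew_lines l | (t <= S)%MS].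
have : lines_in L S \subset l |: T.
  apply/subsetP=> x xS; have /lines_inP[xL xSS] := xS.
  have [-> | xl] := eqVneq x l; first by rewrite !inE eqxx.
  have := no_meet x; rewrite /= xS xl lt0n /= => /negbFE lx0.
  by rewrite !inE xL xSS lx0 orbT.
have two : 1 < #|lines_in L S|.
  apply/card_gt1P; exists l, m; rewrite !inE lL (skew_lines_L ml) addsmxSl addsmxSr.
  by split=> //; apply: contraTneq ml => <-; exact: notin_skew_lines.
have lT : l \notin T by rewrite inE (negbTE (notin_skew_lines lL)).
move/subset_leq_card; rewrite cardsU1 lT add1n -ltnS.
exact: leq_trans (card_lines_in_solid_gt1 (rank_add_skew lL ml) two).
Qed.

Section LineMeetingM.
Variables (M l : mx).
Hypotheses (lL : l \in L) (lM : \rank (l :&: M)%MS = 1).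
Local Notation P0 := (l :&: M)%MS.

Lemma l_notin_M : ~~ (l <= M)%MS.
Proof.
apply/negP => lM'; have := mxrank_cap_geq (submx_refl l) lM'.
by rewrite lM (rank_L lL).
Qed.

Lemma card_lines_through_P0 : #|lines_through L P0| = q.+1.
Proof. exact: card_lines_through lM lL (capmxSl l M). Qed.

Lemma card_skew_lines_bound : #|skew_lines l| + q.+1 <= #|L|.
Proof.
have disj : skew_lines l :&: lines_through L P0 = set0.
  apply/setP=> t; rewrite !inE; apply/negP => /andP[/andP[_ /eqP lt0] /andP[_ P0t]].
  by have := mxrank_cap_geq (capmxSl l M) P0t; rewrite lt0 lM.
rewrite -card_lines_through_P0 -cardsUI disj cards0 addn0.
by apply/subset_leq_card/subsetP=> t; rewrite !inE => /orP[] /andP[].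
Qed.

Lemma meets_l_in_M (x : mx) : (x <= M)%MS -> 0 < \rank (l :&: x)%MS -> (P0 <= x)%MS.
Proof.
move=> xM lx; have lxP0 : (l :&: x <= P0)%MS by rewrite capmxS.
have : (P0 <= l :&: x)%MS by apply: submx_rank_geq lxP0 _; rewrite lM.
by move/submx_trans; apply; exact: capmxSr.
Qed.

Definition lines_in_M_off := lines_in L M :\: lines_through L P0.

Lemma lines_in_M_offP m :
  reflect [/\ m \in L, (m <= M)%MS & ~~ (P0 <= m)%MS] (m \in lines_in_M_off).
Proof.
rewrite !inE; apply: (iffP idP) => [/andP[P0m /andP[mL mM]] | [mL mM P0m]].
  by split=> //; move: P0m; rewrite mL.
by rewrite mL mM P0m.
Qed.

Lemma lines_in_M_off_skew m : m \in lines_in_M_off -> m \in skew_lines l.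
Proof.
case/lines_in_M_offP=> mL mM P0m; rewrite inE mL -leqn0 leqNgt /=.
by apply: contra P0m; exact: meets_l_in_M.
Qed.

(* In canonical form, so that a solid is determined as a matrix. *)
Definition lsolid (x : mx) := <<(l + x)%MS>>%MS.

Lemma lsolid_eq t m : t \in skew_lines l -> m \in skew_lines l ->
  (t <= l + m)%MS -> lsolid t = lsolid m.
Proof.
move=> tl ml tS; apply/genmxP; have sub : (l + t <= l + m)%MS by rewrite addsmx_sub addsmxSl.
by rewrite sub submx_rank_geq // (rank_add_skew lL tl) (rank_add_skew lL ml).
Qed.

Lemma lsolid_sub x : (l <= lsolid x)%MS && (x <= lsolid x)%MS.
Proof. by rewrite !genmxE addsmxSl addsmxSr. Qed.

Lemma lsolid_pencil m1 m2 : m1 \in lines_in_M_off -> m2 \in lines_in_M_off -> m1 != m2 ->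
    lsolid m1 = lsolid m2 ->
  [/\ \rank (lsolid m1 :&: M)%MS = 3, \rank (m1 :&: m2)%MS = 1,
      lines_through L (m1 :&: m2)%MS \subset lines_in L (lsolid m1 :&: M)%MS &
      exists2 x, x \in lines_through L (m1 :&: m2)%MS & (P0 <= x)%MS].
Proof.
move=> /[dup] m1off /lines_in_M_offP[m1L m1M P0m1] /lines_in_M_offP[m2L m2M _].
move=> m12 eS; set S := lsolid m1; set pi := (S :&: M)%MS.
have /andP[lS m1S] : (l <= S)%MS && (m1 <= S)%MS := lsolid_sub m1.
have m2S : (m2 <= S)%MS by rewrite /S eS; case/andP: (lsolid_sub m2).
have m1pi : (m1 <= pi)%MS by rewrite sub_capmx m1S.
have m2pi : (m2 <= pi)%MS by rewrite sub_capmx m2S.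
have P0pi : (P0 <= pi)%MS by rewrite sub_capmx capmxSr (submx_trans (capmxSl l M)).
have SM : ~~ (S <= M)%MS by apply: contra l_notin_M; apply: submx_trans.
have rS : \rank S = 4 by rewrite mxrank_gen (rank_add_skew lL (lines_in_M_off_skew m1off)).
have rP0m1 : \rank (m1 + P0)%MS = 3 by rewrite mxrank_add_rank1 // (rank_L m1L).
have rpi : \rank pi = 3.
  apply/eqP; rewrite eqn_leq; apply/andP; split.
    by have := mxrank_cap_notsub SM; rewrite capmxC rS; apply.
  by rewrite -rP0m1 mxrankS // addsmx_sub m1pi.
have rC : \rank (m1 :&: m2)%MS = 1.
  apply: pg_lines_coplanar_cap (L_pg_line m1L) (L_pg_line m2L) _ _ m1pi m2pi; last by rewrite rpi.
  exact: pg_lines_neq_sub (L_pg_line m1L) (L_pg_line m2L) m12.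
have pencil_pi : lines_through L (m1 :&: m2)%MS \subset lines_in L pi.
  apply/subsetP=> t tC; have /lines_throughP[tL _] := tC; apply/lines_inP; split=> //.
  apply: submx_trans (lines_through_in_span m1L m2L m12 rC _ _ tC) _; rewrite ?capmxSl ?capmxSr //.
  by rewrite addsmx_sub m1pi.
split=> //; apply: (pencil_covers_plane rpi rC lM _ P0pi).
- by rewrite sub_capmx (submx_trans (capmxSl _ _) m1S) (submx_trans (capmxSl _ _) m1M).
- by apply/subsetP=> t; rewrite inE => /andP[/L_pg_line].
- by rewrite hq (card_lines_through rC m1L (capmxSl _ _)).
- move=> t tC; have := subsetP pencil_pi t tC; move: tC.
  by rewrite !inE => /andP[_ ->] /andP[_ ->].
Qed.

Lemma lsolid_props m : m \in lines_in_M_off ->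
  [/\ <<lsolid m>>%MS = lsolid m, \rank (lsolid m) = 4 & (l <= lsolid m)%MS].
Proof.
move=> moff; rewrite /lsolid genmx_id mxrank_gen genmxE addsmxSl.
by rewrite (rank_add_skew lL (lines_in_M_off_skew moff)).
Qed.

Definition solid_fiber (S : mx) := [set m in lines_in_M_off | lsolid m == S].
Definition skew_in_solid (S : mx) := [set t in skew_lines l | lsolid t == S].
Definition big_solids := [set S in lsolid @: lines_in_M_off | 1 < #|solid_fiber S|].

Lemma in_solid_fiber m S : (m \in solid_fiber S) = (m \in lines_in_M_off) && (lsolid m == S).
Proof. by rewrite in_set. Qed.

Lemma card_skew_in_solid m : m \in lines_in_M_off -> q <= #|skew_in_solid (lsolid m)|.
Proof.
move=> moff; have ml := lines_in_M_off_skew moff.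
apply: leq_trans (card_skew_lines_in_solid lL ml) _; apply/subset_leq_card/subsetP=> t.
by rewrite in_set => /andP[tl tS]; rewrite in_set tl (lsolid_eq tl ml tS) eqxx.
Qed.

Lemma big_solidP S : S \in big_solids ->
  exists C, [/\ \rank C = 1, \rank (S :&: M)%MS = 3,
    lines_through L C \subset lines_in L (S :&: M)%MS &
    exists2 x, x \in lines_through L C & (P0 <= x)%MS].
Proof.
rewrite in_set => /andP[_ /card_gt1P[m1 [m2 []]]].
rewrite !in_solid_fiber => /andP[m1off /eqP <-] /andP[m2off /eqP e2] m12.
have [rpi rC pencil P0x] := lsolid_pencil m1off m2off m12 (esym e2).
by exists (m1 :&: m2)%MS.
Qed.

Lemma card_solid_fiber_le S : S \in big_solids -> #|solid_fiber S| <= q.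
Proof.
move=> /big_solidP[C [_ rpi pencil [x xC P0x]]].
have : solid_fiber S \subset lines_in L (S :&: M)%MS :\ x.
  apply/subsetP=> m; rewrite in_solid_fiber => /andP[/lines_in_M_offP[mL mM P0m] /eqP <-].
  rewrite !inE mL sub_capmx mM andbT; have /andP[_ ->] := lsolid_sub m.
  by rewrite andbT; apply/andP; split=> //; apply: contraNneq P0m => ->.
move/subset_leq_card; have := cardsD1 x (lines_in L (S :&: M)%MS).
rewrite (subsetP pencil x xC) add1n => e; move/leq_trans; apply.
by rewrite -ltnS -e card_lines_in_plane_le.
Qed.

Lemma solid_fiber_bound S : S \in lsolid @: lines_in_M_off ->
  q * #|solid_fiber S| <= #|skew_in_solid S| + (1 < #|solid_fiber S|) * (q * q - q).
Proof.
move=> /imsetP[m moff ->]; have skew := card_skew_in_solid moff.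
case: (ltnP 1 #|solid_fiber (lsolid m)|) => [big | small].
  have fq : #|solid_fiber (lsolid m)| <= q.
    by apply: card_solid_fiber_le; rewrite in_set imset_f.
  rewrite mul1n; apply: leq_trans (_ : q * q <= _); first by rewrite leq_mul2l fq orbT.
  have qq : q <= q * q by case: q {skew fq} => // q'; rewrite leq_pmulr.
  by rewrite -{1}(subnKC qq) leq_add2r.
rewrite mul0n addn0; apply: leq_trans skew.
by rewrite -{2}[q]muln1 leq_mul2l small orbT.
Qed.

Lemma card_lines_in_M_off_le :
  q * #|lines_in_M_off| <= #|skew_lines l| + #|big_solids| * (q * q - q).
Proof.
set B := lsolid @: lines_in_M_off.
rewrite -(sum_card_fibers_imset lsolid lines_in_M_off) big_distrr /=.
apply: leq_trans (_ : \sum_(S in B)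
    (#|skew_in_solid S| + (1 < #|solid_fiber S|) * (q * q - q)) <= _).
  exact: leq_sum solid_fiber_bound.
rewrite big_split /= leq_add ?sum_card_fibers_le // -big_distrl /= leq_mul2r.
apply/orP; right; rewrite -sum1_card (eq_bigl (fun S => (S \in B) && (1 < #|solid_fiber S|))).
  by rewrite big_mkcondr /=; apply: leq_sum => S _; case: ltnP.
by move=> S; rewrite in_set.
Qed.

Lemma card_L_lower : q * #|lines_in_M_off| + q.+1 <= #|L| + #|big_solids| * (q * q - q).
Proof.
apply: leq_trans (leq_add card_lines_in_M_off_le (leqnn q.+1)) _.
by rewrite addnAC leq_add2r card_skew_lines_bound.
Qed.

Lemma lines_through_P0_meet (t : mx) : (P0 <= t)%MS -> 0 < \rank (l :&: t)%MS.
Proof. by move=> P0t; rewrite -lM; exact: mxrank_cap_geq (capmxSl l M) P0t. Qed.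

Section NoLineOfMMeetsL.
Hypothesis skewM : forall s, s \in lines_in L M -> \rank (l :&: s)%MS = 0.

Lemma lines_in_M_off_all : lines_in_M_off = lines_in L M.
Proof.
apply/setP=> m; apply/lines_in_M_offP/idP => [[mL mM _] | mLM]; first by rewrite inE mL mM.
have /lines_inP[mL mM] := mLM; split=> //.
by apply/negP => /lines_through_P0_meet; rewrite skewM.
Qed.

Lemma no_big_solids : big_solids = set0.
Proof.
apply/setP=> S; rewrite in_set0; apply/negbTE/negP => /big_solidP[C [_ _ pencil [x xC P0x]]].
have /lines_inP[xL xpi] := subsetP pencil x xC.
have xM : x \in lines_in L M by rewrite inE xL (submx_trans xpi) ?capmxSr.
by have := lines_through_P0_meet P0x; rewrite skewM.
Qed.

Lemma card_L_skew_to_M : q * #|lines_in L M| + 1 <= #|L|.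
Proof.
have := card_L_lower; rewrite lines_in_M_off_all no_big_solids cards0 mul0n addn0.
by apply: leq_trans; rewrite leq_add2l.
Qed.

End NoLineOfMMeetsL.

Lemma big_solid_props S : S \in big_solids ->
  [/\ <<S>>%MS = S, \rank S = 4 & (l <= S)%MS].
Proof. by rewrite in_set => /andP[/imsetP[m moff ->] _]; exact: lsolid_props. Qed.

Lemma rank_add_plane_in_M (W : mx) : (W <= M)%MS -> \rank W = 3 -> 4 <= \rank (l + W)%MS.
Proof.
move=> WM rW; have : \rank (l :&: W)%MS <= 1 by rewrite -lM mxrankS ?capmxS.
have := mxrank_sum_cap l W; rewrite rW (rank_L lL); lia.
Qed.

Section LineOfMThroughP0.
Variable s : mx.
Hypotheses (sM : s \in lines_in L M) (ls : 0 < \rank (l :&: s)%MS).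

Definition qM_points_on_s := [set P | qM_point q L M P & (P <= s)%MS].

Lemma lines_in_M_through_P0 x : x \in lines_in L M -> (P0 <= x)%MS -> x = s.
Proof.
move=> xLM P0x; apply/eqP; apply: contraT => xs.
have /lines_inP[xL xM] := xLM.
have /lines_inP[sL sMM] := sM.
have lP0 : l \in lines_through L P0 by rewrite inE lL capmxSl.
have xsM : (x + s <= M)%MS by rewrite addsmx_sub xM sMM.
have P0s : (P0 <= s)%MS := meets_l_in_M sMM ls.
by have := l_notin_M; rewrite (submx_trans (lines_through_in_span xL sL xs lM P0x P0s lP0) xsM).
Qed.

Lemma card_lines_in_M_le : #|lines_in L M| <= #|lines_in_M_off| + 1.
Proof.
have : lines_in L M \subset s |: lines_in_M_off.
  apply/subsetP=> m mLM; rewrite in_setU1.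
  have [P0m | P0m] := boolP (P0 <= m)%MS; first by rewrite (lines_in_M_through_P0 mLM P0m) eqxx.
  by apply/orP; right; case/lines_inP: mLM => mL mM; apply/lines_in_M_offP.
by move/subset_leq_card; rewrite cardsU1 addnC => /leq_trans; apply; rewrite leq_add2l leq_b1.
Qed.

Lemma card_qM_points_on_s_le : #|qM_points_on_s| <= q.
Proof.
have /lines_inP[sL sMM] := sM.
have P0s : (P0 <= s)%MS := meets_l_in_M sMM ls.
set Pts := [set Y in pg_points F n | (Y <= s)%MS].
have P0pt : <<P0>>%MS \in Pts by rewrite inE genmx_subspace // genmxE P0s.
have P0_not_qM : #|lines_in (lines_through L P0) M| != q.+1.
  have : lines_in (lines_through L P0) M \subset lines_through L P0 :\ l.
    apply/subsetP=> t; rewrite !inE => /andP[/andP[tL P0t] tM]; rewrite tL P0t !andbT.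
    by apply: contraNneq l_notin_M => <-.
  move/subset_leq_card; have := cardsD1 l (lines_through L P0).
  rewrite card_lines_through_P0 inE lL capmxSl add1n => /eqP; rewrite eqSS => /eqP <-.
  by move=> le; rewrite ltn_eqF.
have : qM_points_on_s \subset Pts :\ <<P0>>%MS.
  apply/subsetP=> C; rewrite in_set /qM_point => /andP[/andP[Cpt cq] Cs].
  rewrite in_setD1 in_set Cpt Cs !andbT.
  by apply: contraTneq cq => ->; rewrite lines_through_genmx.
move/subset_leq_card; have := cardsD1 (<<P0>>%MS) Pts; rewrite P0pt add1n => e.
move/leq_trans; apply; rewrite -ltnS -e -hq; apply: card_points_on_line.
exact: rank_L.
Qed.

Lemma big_solid_qM_point S : S \in big_solids ->
  exists2 C, C \in qM_points_on_s & lines_through L C \subset lines_in L S.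
Proof.
move=> /big_solidP[C [rC _ pencil [x xC P0x]]].
have /lines_inP[xL xpi] := subsetP pencil x xC.
have xs : x = s by apply: lines_in_M_through_P0 => //; rewrite inE xL (submx_trans xpi) ?capmxSr.
have /lines_throughP[_ Cx] := xC.
have in_M : lines_in (lines_through L C) M = lines_through L C.
  apply/setP=> t; rewrite in_set; case tC: (t \in lines_through L C) => //=.
  have /lines_inP[_ tpi] := subsetP pencil t tC; exact: submx_trans tpi (capmxSr _ _).
exists <<C>>%MS.
  rewrite in_set /qM_point genmx_subspace //= lines_through_genmx in_M.
  by rewrite (card_lines_through rC xL Cx) eqxx genmxE -xs Cx.
rewrite lines_through_genmx; apply/subsetP=> t tC.
have /lines_inP[tL tpi] := subsetP pencil t tC.
by apply/lines_inP; split=> //; exact: submx_trans tpi (capmxSl _ _).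
Qed.

Lemma qM_point_solid_eq C S S' : C \in qM_points_on_s ->
    S \in big_solids -> S' \in big_solids ->
    lines_through L C \subset lines_in L S -> lines_through L C \subset lines_in L S' ->
  S = S'.
Proof.
rewrite in_set /qM_point => /andP[/andP[Cpt /eqP cq] _] Sb S'b CS CS'.
move: Cpt; rewrite inE => /andP[_ /eqP rC].
have : 1 < #|lines_in (lines_through L C) M|.
  by rewrite cq ltnS ltnW // -hq card_finNzRing_gt1.
case/card_gt1P=> [m1 [m2 [/lines_inP[m1C m1M] /lines_inP[m2C m2M] m12]]].
have /lines_throughP[m1L Cm1] := m1C; have /lines_throughP[m2L Cm2] := m2C.
have W3 := pg_lines_meet (L_pg_line m1L) (L_pg_line m2L) m12 rC Cm1 Cm2.
have WM : (m1 + m2 <= M)%MS by rewrite addsmx_sub m1M m2M.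
have Z4 := rank_add_plane_in_M WM W3.
have solid_of T : T \in big_solids -> lines_through L C \subset lines_in L T ->
    (T <= l + (m1 + m2))%MS && (l + (m1 + m2) <= T)%MS.
  move=> Tb CT; have [_ rT lT] := big_solid_props Tb.
  have /lines_inP[_ m1T] := subsetP CT m1 m1C.
  have /lines_inP[_ m2T] := subsetP CT m2 m2C.
  have sub : (l + (m1 + m2) <= T)%MS by rewrite !addsmx_sub lT m1T m2T.
  by rewrite sub andbT; apply: submx_rank_geq sub _; rewrite rT.
have [gS rS _] := big_solid_props Sb; have [gS' rS' _] := big_solid_props S'b.
have /andP[SZ _] := solid_of S Sb CS; have /andP[_ ZS'] := solid_of S' S'b CS'.
apply: genmx_submx_rank_eq gS gS' (submx_trans SZ ZS') _.
by rewrite rS' rS.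
Qed.

Lemma card_big_solids_le : #|big_solids| <= #|qM_points_on_s|.
Proof.
pose pt S := odflt 0%R [pick C in qM_points_on_s | lines_through L C \subset lines_in L S].
have ptP S : S \in big_solids ->
    (pt S \in qM_points_on_s) && (lines_through L (pt S) \subset lines_in L S).
  move=> Sb; rewrite /pt; case: pickP => [C /andP[-> ->] // | none].
  by have [C CQ CS] := big_solid_qM_point Sb; have := none C; rewrite CQ CS.
have pt_inj : {in big_solids &, injective pt}.
  move=> S S' Sb S'b eq; have /andP[CQ CS] := ptP S Sb; have /andP[_ CS'] := ptP S' S'b.
  by apply: qM_point_solid_eq CQ Sb S'b CS _; rewrite eq.
rewrite -(card_in_imset pt_inj); apply/subset_leq_card/subsetP=> _ /imsetP[S Sb ->].
by case/andP: (ptP S Sb).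
Qed.

Lemma card_L_line_through_P0 :
  q * #|lines_in L M| + 1 <= #|L| + #|qM_points_on_s| * (q * q - q).
Proof.
apply: leq_trans (_ : q * #|lines_in_M_off| + q.+1 <= _).
  have := leq_mul (leqnn q) card_lines_in_M_le; rewrite mulnDr muln1.
  by rewrite -[q.+1]addn1 addnA leq_add2r.
apply: leq_trans card_L_lower _.
by rewrite leq_add2l leq_mul2r card_big_solids_le orbT.
Qed.

End LineOfMThroughP0.

End LineMeetingM.

End LineSet.

Lemma int_bounds_of_nat_bound (q a b alpha : nat) : alpha <= q ->
    q * a + 1 <= b + alpha * (q * q - q) ->
  (Posz (q * a) - Posz (alpha * q ^ 2) + Posz (alpha * q) + 1 <= Posz b)%R /\
  (Posz (q * a) - Posz (q ^ 3) + Posz (q ^ 2) + 1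
     <= Posz (q * a) - Posz (alpha * q ^ 2) + Posz (alpha * q) + 1)%R.
Proof. nia. Qed.

Theorem proposition3 (F : finFieldType) (n q : nat) (hq : #|F| = q)
  (L : {set 'M[F]_(n.+1)})
  (Lsub : L \subset pg_lines F n)
  (Lne : L != set0)
  (Pt : forall P, P \in pg_points F n ->
          #|lines_through L P| = 0 \/ #|lines_through L P| = q.+1)
  (Pl : forall W, W \in pg_planes F n ->
          #|lines_in L W| \in [:: 0; 1; q.+1])
  (Sd : forall W, W \in pg_solids F n ->
          #|lines_in L W| \in [:: 0; 1; q.+1; (2 * q).+1])
  (To : #|L| <= q ^ 5 + q ^ 4 + q ^ 3 + q ^ 2 + q + 1)
  (M : 'M[F]_(n.+1)) (l : 'M[F]_(n.+1))
  (hl : l \in L) (hlM : \rank (l :&: M)%MS = 1) :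
  ((forall s, s \in lines_in L M -> \rank (l :&: s)%MS = 0) ->
     q * #|lines_in L M| + 1 <= #|L|)
  /\
  (forall (s : 'M[F]_(n.+1)) (alpha : nat),
     s \in lines_in L M -> 0 < \rank (l :&: s)%MS ->
     #|[set P | qM_point q L M P & (P <= s)%MS]| = alpha ->
     (Posz (q * #|lines_in L M|) - Posz (alpha * q ^ 2) + Posz (alpha * q) + 1
        <= Posz #|L|)%R /\
     (Posz (q * #|lines_in L M|) - Posz (q ^ 3) + Posz (q ^ 2) + 1
        <= Posz (q * #|lines_in L M|) - Posz (alpha * q ^ 2) + Posz (alpha * q) + 1)%R).
Proof.
(* Neither Lne nor To is needed. *)
split=> [skewM | s alpha hs hsl <-].
  by have := card_L_skew_to_M hq Lsub Pt Pl Sd hl hlM skewM.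
have alpha_le := card_qM_points_on_s_le hq Lsub Pt hl hlM hs hsl.
have bound := card_L_line_through_P0 hq Lsub Pt Pl Sd hl hlM hs hsl.
exact: int_bounds_of_nat_bound alpha_le bound.
Qed.
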